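(* Let $\mathcal{C}$ be an acyclic SCM over $d$ variables indexed by $V=\{1,\dots,d\}$ with associated DAG $\mathcal{G}=(V,E)$. Assume that every variable is intervened on, i.e. $\mathcal{I}=V$, and that we are given the observational distribution $P_X^{\mathcal{C},(\emptyset)}$ and the interventional distributions $P_X^{\mathcal{C},do(X_k:=\tilde N_k)}$ for all $k\in\mathcal{I}$, such that $(\tilde N,\mathcal{C})$ is $\epsilon$-interventionally faithful to $\mathcal{G}$ for some $\epsilon>0$. Let $c_0>\epsilon$ be the constant in the score $\mathcal{S}$, and let $\pi_{opt}\in\arg\max_\pi\mathcal{S}(\pi)$, the maximum being over all permutations $\pi$ of $\{1,\dots,d\}$. Then, for any causal ordering $\pi^*$ of $\mathcal{G}$, $$D_{top}(\mathcal{G},\pi_{opt})=D_{top}(\mathcal{G},\pi^* )=0 .$$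
   Context: **SCMs and interventions.** $(M,\mathrm{dist})$ is a metric space and $\mathcal{P}(M)$ the set of probability measures on $M$. $D:\mathcal{P}(M)\times\mathcal{P}(M)\to[0,\infty)$ is a distance between probability measures (in particular $D(P,Q)=0$ iff $P=Q$). An acyclic structural causal model (SCM) $\mathcal{C}$ over $X=(X_1,\dots,X_d)$, each $X_j$ taking values in $M$, consists of assignments $X_j:=f_j(X_{\mathbf{Pa}_j},N_j)$, $j\in V$, with $\mathbf{Pa}_j\subseteq V\setminus\{j\}$ and jointly independent noise variables $N_1,\dots,N_d$; its associated graph $\mathcal{G}=(V,E)$, with $(i,j)\in E$ iff $i\in\mathbf{Pa}_j$, is assumed to be acyclic. $P_X^{\mathcal{C},(\emptyset)}$ is the (observational) distribution of $X$. A single-variable intervention $do(X_k:=\tilde N_k)$ replaces the assignment of $X_k$ by $X_k:=\tilde N_k$, where $\tilde N_k$ is a random variable independent of the parents (the noises of the modified SCM being again jointly independent); the resulting distribution is $P_X^{\mathcal{C},do(X_k:=\tilde N_k)}$. $\mathcal{I}\subseteq V$ is the set of intervened variables, and $\tilde N=\{\tilde N_k:k\in\mathcal{I}\}$. A subscript $X_j$ denotes the marginal distribution of $X_j$. Write $D_{ij}=D\big(P_{X_j}^{\mathcal{C},(\emptyset)},P_{X_j}^{\mathcal{C},do(X_i:=\tilde N_i)}\big)$ for $i\in\mathcal{I}$, $j\in V$. **$\epsilon$-interventional faithfulness.** $(\tilde N,\mathcal{C})$ is $\epsilon$-interventionally faithful to $\mathcal{G}$ if for all $i\in\mathcal{I}$,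 $j\in V$, $i\ne j$: $D_{ij}>\epsilon$ if and only if there is a directed path from $i$ to $j$ in $\mathcal{G}$. **Causal orders.** A permutation is a bijection $\pi:\{1,\dots,d\}\to\{1,\dots,d\}$. It is a causal ordering of $\mathcal{G}$ if $\pi(i)<\pi(j)$ whenever there is a directed path from $i$ to $j$ in $\mathcal{G}$. The top order divergence is $D_{top}(\mathcal{G},\pi)=\#\{(i,j)\in E:\pi(i)>\pi(j)\}$. **Score.** For $\epsilon>0$ and a constant $c_0>\epsilon$, $$\mathcal{S}(\pi)=\sum_{\substack{i\in\mathcal{I},\,j\in V\\ \pi(i)<\pi(j)}}\Big[(D_{ij}-\epsilon)+c_0\, d\,\mathbf{1}_{\{D_{ij}>\epsilon\}}\Big].$$ *)

(* Defs.v *)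
From HB Require Import structures.
From mathcomp Require Import all_boot all_order all_algebra perm.
From mathcomp Require Import all_classical all_reals all_analysis.

Set Implicit Arguments.
Unset Strict Implicit.
Unset Printing Implicit Defensive.

Import Order.TTheory GRing.Theory Num.Theory.
Local Open Scope classical_set_scope.
Local Open Scope ring_scope.

(* Metric spaces with a point: a measurableType carries a point, and a space in
   which random variables take values is nonempty anyway. *)
#[short(type="pointedMetricType")]
HB.structure Definition PointedMetric (R : numDomainType) :=
  {M of Metric R M & isPointed M}.

(* M with its Borel sigma-algebra. *)
Definition borel (R : realType) (M : pointedMetricType R) :
    measurableType (@open M).-sigma :=
  g_sigma_algebraType (@open M).

(* Library measures are functions on all subsets, with unspecified values
   outside the sigma-algebra; hence two probability measures are identified when
   they agree on the measurable sets, not when they are Leibniz-equal. *)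
Record prob_distance (R : realType) (M : pointedMetricType R)
    (D : probability (borel M) R -> probability (borel M) R -> R) : Prop := {
  prob_distance_ge0 : forall P Q, 0 <= D P Q;
  prob_distance_eq0 : forall P Q,
    D P Q = 0 <-> (forall A, measurable A -> P A = Q A);
  prob_distance_sym : forall P Q, D P Q = D Q P;
  prob_distance_triangle : forall P Q S, D P S <= D P Q + D Q S }.

Section causal_orders.
Context (d : nat).
Implicit Types (E : rel 'I_d) (pi : 'S_d).

(* Directed paths have at least one edge. *)
Definition dipath E (i j : 'I_d) : Prop :=
  exists p : seq 'I_d, [/\ p != [::], path E i p & last i p = j].

Definition acyclic E : Prop := forall i, ~ dipath E i i.

Definition causal_order E pi : Prop :=
  forall i j, dipath E i j -> (pi i < pi j)%N.

Definition top_order_divergence E pi : nat :=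
  #|[set e : 'I_d * 'I_d | E e.1 e.2 && (pi e.2 < pi e.1)%N]%SET|.

End causal_orders.

Section scm.
Context (R : realType) (M : pointedMetricType R).
Context (dW : measure_display) (W : measurableType dW) (P : probability W R).
Context (d : nat).

(* One assignment X_j := f_j(X_{Pa_j}, N_j). The noise N_j may live in any
   measurable space. f_j receives the values of the parents listed by increasing
   index. *)
Record mechanism := Mechanism {
  parents : {set 'I_d};
  noise_display : measure_display;
  noise_space : measurableType noise_display;
  noise : {RV P >-> noise_space};
  assignment :
    {mfun (#|parents|.-tuple (borel M) * noise_space)%type >-> borel M} }.

Definition assignments := 'I_d -> mechanism.

Definition graph (C : assignments) : rel 'I_d :=
  fun i j => i \in parents (C j).

Definition independent_noises (C : assignments) : Prop :=
  forall (J : {set 'I_d}) (B : forall j, set (noise_space (C j))),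
    (forall j, measurable (B j)) ->
    P (\bigcap_(j in [set` J]) noise (C j) @^-1` B j) =
      (\prod_(j in J) P (noise (C j) @^-1` B j))%E.

Record acyclic_scm (C : assignments) : Prop := {
  scm_parents : forall j, j \notin parents (C j);
  scm_acyclic : acyclic (graph C);
  scm_noises : independent_noises C }.

Definition parent_values (C : assignments) (x : d.-tuple (borel M)) (j : 'I_d) :
    #|parents (C j)|.-tuple (borel M) :=
  [tuple tnth x (enum_val i) | i < #|parents (C j)|].

Definition update (C : assignments) (w : W) (x : d.-tuple (borel M)) :
    d.-tuple (borel M) :=
  [tuple assignment (C j) (parent_values C x j, noise (C j) w) | j < d].

(* The variables X = (X_1, ..., X_d), as a function on the sample space. When the
   graph is acyclic, d rounds of simultaneous updates reach the unique solution
   of the assignments, whatever the starting values: see solutionP and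
   solution_unique. *)
Definition solution (C : assignments) (w : W) : d.-tuple (borel M) :=
  iter d (update C w) [tuple point | _ < d].

Lemma measurable_iter_update (C : assignments) (x0 : d.-tuple (borel M)) n :
  measurable_fun [set: W] (fun w => iter n (update C w) x0).
Proof.
elim: n => [|n IHn]; first exact: measurable_cst.
apply/measurable_fun_tnthP => j.
rewrite (_ : _ \o _ = assignment (C j) \o
  (fun w => (parent_values C (iter n (update C w) x0) j, noise (C j) w))); last first.
  by apply/funext => w /=; rewrite tnth_mktuple.
apply: measurableT_comp => //; apply: measurable_fun_pair => //.
apply/measurable_fun_tnthP => i.
rewrite (_ : _ \o _ = (@tnth d (borel M) ^~ (enum_val i)) \o
  (fun w => iter n (update C w) x0)); last first.
  by apply/funext => w /=; rewrite tnth_mktuple.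
by apply: measurableT_comp => //; exact: measurable_tnth.
Qed.

HB.instance Definition _ (C : assignments) :=
  isMeasurableFun.Build _ _ W (d.-tuple (borel M)) (solution C)
    (measurable_iter_update C _ d).

Definition coordinate (j : 'I_d) (x : d.-tuple (borel M)) : borel M := tnth x j.

HB.instance Definition _ (j : 'I_d) :=
  isMeasurableFun.Build _ _ (d.-tuple (borel M)) (borel M) (coordinate j)
    (measurable_tnth j).

Definition scm_law (C : assignments) : probability (d.-tuple (borel M)) R :=
  distribution P (solution C).

Definition marginal (Q : probability (d.-tuple (borel M)) R) (j : 'I_d) :
    probability (borel M) R :=
  distribution Q (coordinate j).

(* do(X_k := Nt): X_k has no parents and is its own noise. *)
Definition do_mechanism (Nt : {RV P >-> borel M}) : mechanism :=
  Mechanism (parents := finset.set0) Nt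
    (MeasurableFun.Pack (MeasurableFun.Class
      (isMeasurableFun.Build _ _ _ _ snd measurable_snd))).

Definition intervene (C : assignments) (k : 'I_d) (Nt : {RV P >-> borel M}) :
    assignments :=
  fun j => if j == k then do_mechanism Nt else C j.

(* D_ij, for the family Nt of intervention variables. *)
Definition interventional_distance
    (D : probability (borel M) R -> probability (borel M) R -> R)
    (C : assignments) (Nt : 'I_d -> {RV P >-> borel M}) (i j : 'I_d) : R :=
  D (marginal (scm_law C) j) (marginal (scm_law (intervene C i (Nt i))) j).

Section solution.
Variable C : assignments.
Hypothesis acC : acyclic (graph C).

Let ancestors j := [set i | `[<dipath (graph C) i j>]]%SET.

Let ancestorsP i j : i \in ancestors j <-> dipath (graph C) i j.
Proof. by rewrite inE; split => /asboolP. Qed.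

Let ancestors_lt i j : graph C i j -> (#|ancestors i| < #|ancestors j|)%N.
Proof.
move=> ij; apply: proper_card; apply/properP; split.
  apply/fintype.subsetP => k /ancestorsP[p [p0 kp lp]]; apply/ancestorsP.
  exists (rcons p j); rewrite rcons_path kp lp last_rcons; split => //.
  by case: (p).
exists i; first by apply/ancestorsP; exists [:: j]; rewrite /= ij.
by apply/negP => /ancestorsP /acC.
Qed.

Let ancestors_ltd j : (#|ancestors j| < d)%N.
Proof.
rewrite -[X in (_ < X)%N](card_ord d); apply: proper_card; apply/properP; split.
  by apply/fintype.subsetP.
by exists j => //; apply/negP => /ancestorsP /acC.
Qed.

Let iter_update w x y n m j : (#|ancestors j| < n)%N -> (#|ancestors j| < m)%N ->
  tnth (iter n (update C w) x) j = tnth (iter m (update C w) y) j.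
Proof.
elim: n m j => // n IHn [//|m] j jn jm /=; rewrite !tnth_mktuple.
congr (assignment (C j) (_, _)); apply: eq_from_tnth => i; rewrite !tnth_mktuple.
have /ancestors_lt ij : graph C (enum_val i) j by exact: enum_valP.
by apply: IHn; exact: leq_trans ij _.
Qed.

Lemma solutionP w j : tnth (solution C w) j =
  assignment (C j) (parent_values C (solution C w) j, noise (C j) w).
Proof.
rewrite -[RHS](tnth_mktuple
  (fun k => assignment (C k) (parent_values C (solution C w) k, noise (C k) w))).
apply: (@iter_update w _ _ d d.+1) => //.
by rewrite ltnS ltnW.
Qed.

Lemma solution_unique w (x : d.-tuple (borel M)) :
  (forall j, tnth x j = assignment (C j) (parent_values C x j, noise (C j) w)) ->
  x = solution C w.
Proof.
move=> xP; have fx : update C w x = x.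
  by apply: eq_from_tnth => j; rewrite tnth_mktuple xP.
rewrite -(iter_fix d fx); apply: eq_from_tnth => j.
exact: iter_update.
Qed.

End solution.

Lemma acyclic_intervene (C : assignments) k Nt :
  acyclic (graph C) -> acyclic (graph (intervene C k Nt)).
Proof.
move=> acC i [p [p0 ip lp]]; apply: (acC i); exists p; split => //.
apply: sub_path ip => a b; rewrite /graph /intervene.
by case: ifP => // _; rewrite inE.
Qed.

End scm.

Definition interventionally_faithful (R : realType) (d : nat)
    (I : {set 'I_d}) (eps : R) (Dm : 'I_d -> 'I_d -> R) (E : rel 'I_d) : Prop :=
  forall i j, i \in I -> i != j -> (eps < Dm i j <-> dipath E i j).

Definition score (R : realType) (d : nat) (I : {set 'I_d}) (eps c0 : R)
    (Dm : 'I_d -> 'I_d -> R) (pi : 'S_d) : R :=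
  \sum_(i in I) \sum_(j < d | (pi i < pi j)%N)
    ((Dm i j - eps) + c0 * d%:R * (eps < Dm i j)%R%:R).

(* Main.v *)
(* If an optimal order puts a descendant b before its ancestor a, choose such a
   pair with the smallest gap. No element strictly between b and a is then an
   ancestor of a, so moving a just in front of b loses no positive term of the
   score; it gains the (a, b) term, larger than c0 d, and adds fewer than d
   further terms, each at least - eps. This contradicts optimality. A direct
   comparison with a causal order would fail, since up to d (d - 1) / 2 terms
   of size - eps could outweigh c0 d. *)
Require Import Defs.
From HB Require Import structures.
From mathcomp Require Import all_boot all_order all_algebra perm.
From mathcomp Require Import all_classical all_reals all_analysis.
From mathcomp Require Import zify lra.
Set Implicit Arguments.
Unset Strict Implicit.
Unset Printing Implicit Defensive.
Import Order.TTheory GRing.Theory Num.Theory.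
Local Open Scope ring_scope.

Lemma dipath_trans (d : nat) (E : rel 'I_d) (i j k : 'I_d) :
  dipath E i j -> dipath E j k -> dipath E i k.
Proof.
move=> [p [p0 ip <-]] [q [_ jq <-]]; exists (p ++ q); split.
- by case: p p0 {ip jq}.
- by rewrite cat_path ip.
- by rewrite last_cat.
Qed.

(** Taking [a] out and reinserting it just in front of [b] moves the block between them up by one
    place, so only comparisons that involve [a] can change. *)
Lemma perm_move_before (d : nat) (pi : 'S_d) (a b : 'I_d) :
  (pi b < pi a)%N ->
  exists pi' : 'S_d, forall i j, (pi' i < pi' j)%N =
    if i == a then (j != a) && (pi b <= pi j)%N
    else if j == a then (pi i < pi b)%N else (pi i < pi j)%N.
Proof.
move=> ba.
(* The new positions: [a] takes the place of [b], and the places from [pi b] to just below [pi a]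
   shift by one, filling the place that [a] leaves. *)
pose f x := if x == a then pi b : nat
  else if (pi b <= pi x < pi a)%N then (pi x).+1 else pi x.
have pi_neq x y : x != y -> (pi x : nat) <> pi y.
  by move=> xy /val_inj/perm_inj /eqP; exact/negP.
have ltf x : (f x < d)%N.
  rewrite /f; case: eqVneq => // _; case: ifP => // h.
  by have := ltn_ord (pi a); lia.
have inj_f : injective (fun x => Ordinal (ltf x)).
  move=> x y [] /eqP fxy; apply/eqP; apply: contraLR fxy => xy; apply/eqP.
  have := pi_neq _ _ xy; rewrite /f.
  case: (eqVneq x a) (eqVneq y a) => [xa|xa] [ya|ya].
  - by rewrite xa ya eqxx in xy.
  - by case: ifP => /=; lia.
  - by case: ifP => /=; lia.
  - have := pi_neq _ _ xa; have := pi_neq _ _ ya.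
    by case: ifP; case: ifP => /=; lia.
exists (perm inj_f) => i j; rewrite !permE /= /f.
case: (eqVneq i a) (eqVneq j a) => [ia|ia] [ja|ja] /=.
- by rewrite ltnn.
- by have := pi_neq _ _ ja; case: ifP; lia.
- by have := pi_neq _ _ ia; case: ifP; lia.
- have := pi_neq _ _ ia; have := pi_neq _ _ ja.
  by case: ifP; case: ifP; lia.
Qed.

(** The exchange argument, freed from causal models: [r] stands for the ancestor relation and
    [w i j] for a term of the score. It relies only on the sizes of the terms inside and outside
    [r]. *)
Lemma argmax_order_extends (R : realFieldType) (d : nat) (r : rel 'I_d)
    (eps : R) (w : 'I_d -> 'I_d -> R) (pi : 'S_d) :
  transitive r -> irreflexive r -> 0 <= eps ->
  (forall i j, r i j -> eps * d%:R < w i j) ->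
  (forall i j, i != j -> ~~ r i j -> - eps <= w i j <= 0) ->
  (forall pi' : 'S_d, \sum_i \sum_(j | (pi' i < pi' j)%N) w i j <=
     \sum_i \sum_(j | (pi i < pi j)%N) w i j) ->
  forall i j, r i j -> (pi i < pi j)%N.
Proof.
move=> rT rI eps_ge0 w_big w_small pi_max i0 j0 rij0; rewrite ltnNge; apply/negP.
move=> pij0; have ij0 : i0 != j0 by apply: contraTneq rij0 => ->; rewrite rI.
have {}pij0 : (pi j0 < pi i0)%N.
  rewrite ltn_neqAle pij0 andbT.
  by rewrite (inj_eq val_inj) (inj_eq perm_inj) eq_sym.
pose bad (e : 'I_d * 'I_d) := r e.1 e.2 && (pi e.2 < pi e.1)%N.
have bad0 : bad (i0, j0) by rewrite /bad /= rij0.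
have [[a b] /andP[/= rab ba] gap_min] :=
  arg_minnP (fun e : 'I_d * 'I_d => (pi e.1 - pi e.2)%N) bad0.
have not_anc x : (pi b <= pi x)%N -> (pi x < pi a)%N -> ~~ r x a.
  (* By transitivity through [a], the pair [(x, b)] would be bad too, with a smaller gap than
     [(a, b)]. *)
  move=> bx xa; apply/negP => rxa; have rxb := rT _ _ _ rxa rab.
  have xb : x != b by apply: contraTneq rxb => ->; rewrite rI.
  have {}bx : (pi b < pi x)%N.
    rewrite ltn_neqAle bx andbT.
    by rewrite (inj_eq val_inj) (inj_eq perm_inj) eq_sym.
  have : bad (x, b) by rewrite /bad /= rxb.
  by move=> /gap_min /=; lia.
have [pi' pi'E] := perm_move_before ba.
have nab : a != b by apply: contraTneq ba => ->; rewrite ltnn.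
have d_gt0 : (0 < d)%N by case: (d) (a) => // -[].
have row_a : \sum_(j | (pi a < pi j)%N) w a j < \sum_(j | (pi' a < pi' j)%N) w a j.
  rewrite [ltLHS]big_mkcond [ltRHS]big_mkcond -subr_gt0 -sumrB /=.
  rewrite (bigD1 b) //= pi'E eqxx eq_sym nab leqnn /= ltnNge (ltnW ba) /= subr0.
  (* Each of the [d - 1] columns other than [b] changes by at least [- eps]. As [w a b] exceeds
     [eps * d], the net gain exceeds [eps], hence is positive. *)
  apply: (@lt_le_trans _ _ (w a b + \sum_(j | j != b) - eps)).
    rewrite sumr_const cardC1 card_ord.
    have := w_big _ _ rab; have -> : d%:R = d.-1%:R + 1 :> R by rewrite natr1 prednK.
    by rewrite mulNrn -mulr_natr mulrDr mulr1 => ?; lra.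
  rewrite lerD2l; apply: ler_sum => j _; rewrite pi'E eqxx.
  have [->|ja] /= := eqVneq j a; first by rewrite ltnn subr0 oppr_le0.
  have w_ge : - eps <= w a j.
    have [raj|nraj] := boolP (r a j).
      rewrite (le_trans _ (ltW (w_big _ _ raj))) //.
      by rewrite (@le_trans _ _ 0) ?oppr_le0 // mulr_ge0.
    by have /andP[] := w_small a j (contra_neq esym ja) nraj.
  (* A term already counted stays counted, since [pi b < pi a < pi j]; otherwise a term is either
     newly counted or absent from both sums. *)
  case: ltnP => aj; first by rewrite (ltnW (ltn_trans ba aj)) subrr oppr_le0.
  by case: ifP => _; rewrite subr0 ?oppr_le0.
have rows i : i != a ->
    \sum_(j | (pi i < pi j)%N) w i j <= \sum_(j | (pi' i < pi' j)%N) w i j.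
  move=> ia; rewrite [leLHS]big_mkcond [leRHS]big_mkcond /=.
  apply: ler_sum => j _; rewrite pi'E (negbTE ia).
  (* Only column [a] can change. The term [w i a] is lost when [i] lies in the shifted block, and
     there [not_anc] makes it nonpositive. *)
  have [->|//] := eqVneq j a.
  case: (ltnP (pi i) (pi a)) => [ija|aij].
    case: ltnP => [//|bi].
    by have /andP[] := w_small i a ia (not_anc _ bi ija).
  by case: ltnP => // ib; lia.
have := pi_max pi'; apply/negP; rewrite -ltNge.
rewrite [ltLHS](bigD1 a) //= [ltRHS](bigD1 a) //=.
by apply: ltr_leD => //; apply: ler_sum => i; exact: rows.
Qed.

Theorem theorem1 (R : realType) (M : pointedMetricType R)
  (D : probability (borel M) R -> probability (borel M) R -> R)
  (D_distance : prob_distance D)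
  (dW : measure_display) (W : measurableType dW) (P : probability W R)
  (d : nat) (C : assignments M P d) (C_scm : acyclic_scm C)
  (I : {set 'I_d}) (I_all : I = [set: 'I_d])
  (Nt : 'I_d -> {RV P >-> borel M})
  (Nt_indep : forall k, k \in I -> independent_noises (intervene C k (Nt k)))
  (eps c0 : R) (eps_gt0 : 0 < eps) (eps_lt_c0 : eps < c0)
  (C_faithful : interventionally_faithful I eps
     (interventional_distance D C Nt) (graph C))
  (piopt : 'S_d)
  (piopt_max : forall pi : 'S_d,
     score I eps c0 (interventional_distance D C Nt) pi <=
     score I eps c0 (interventional_distance D C Nt) piopt)
  (pistar : 'S_d) (pistar_causal : causal_order (graph C) pistar) :
  top_order_divergence (graph C) piopt = top_order_divergence (graph C) pistar /\
  top_order_divergence (graph C) pistar = 0%N.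
Proof.
have star0 : top_order_divergence (graph C) pistar = 0%N.
  apply: eq_card0 => -[i j]; rewrite inE /=; apply/negP => /andP[Eij].
  apply/negP; rewrite -leqNgt ltnW //; apply: pistar_causal.
  by exists [:: j]; rewrite /= Eij.
rewrite star0; split => //.
set Dm := interventional_distance D C Nt in C_faithful piopt_max.
have faithful i j : i != j -> eps < Dm i j <-> dipath (graph C) i j.
  by apply: C_faithful; rewrite I_all inE.
have Dm_ge0 i j : 0 <= Dm i j by exact: prob_distance_ge0.
have irr i : ~ dipath (graph C) i i by exact: scm_acyclic.
pose r i j := `[< dipath (graph C) i j >].
(* An optimal order is thus itself a causal order, so no edge is reversed. *)
have ext i j : r i j -> (piopt i < piopt j)%N.
  apply: (@argmax_order_extends R d r eps
    (fun i j => (Dm i j - eps) + c0 * d%:R * (eps < Dm i j)%R%:R)).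
  - by move=> ? ? ? /asboolP xy /asboolP yz; apply/asboolP/(dipath_trans xy yz).
  - by move=> x; apply/asboolP.
  - exact: ltW.
  - move=> x y /asboolP xy.
    have nxy : x != y by apply: contra_notN (irr x) => /eqP {2}->.
    have Dxy : eps < Dm x y by apply/faithful.
    (* The excess [Dm x y - eps] gives strictness, and [eps < c0] bounds the jump [c0 * d] below by
       [eps * d]. *)
    rewrite Dxy mulr1 ltr_pwDl ?subr_gt0 //.
    by rewrite ler_wpM2r // ltW.
  - move=> x y nxy /asboolPn xy.
    have /negbTE Dxy : ~~ (eps < Dm x y) by apply/negP => /(faithful _ _ nxy).
    (* Without a path the jump vanishes, and [0 <= Dm x y <= eps] puts the term in [[- eps, 0]]. *)
    rewrite Dxy mulr0 addr0 lerBrDr addNr Dm_ge0 subr_le0 leNgt Dxy //.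
  - move=> pi; have := piopt_max pi; rewrite /score I_all.
    by under eq_bigl do rewrite inE; under [leRHS]eq_bigl do rewrite inE.
apply: eq_card0 => -[i j]; rewrite inE /=; apply/negP => /andP[Eij].
apply/negP; rewrite -leqNgt ltnW //; apply: ext; apply/asboolP.
by exists [:: j]; rewrite /= Eij.
Qed.
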